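(* Let $F$ be a C-function with $F(\beta_0)=1$ and $\mathfrak{L}_F$ positive definite, let $\phi_n\in\mathcal{L}_n\setminus\{0\}$ with $\phi_n\perp_F\mathcal{L}_{n-1}$ $(n\ge0)$, let $\psi_n$ be the rational function of the second kind of $\phi_n$, and for each $k\geq 0$ let $\phi^{(k)}_{n\setminus k},\psi^{(k)}_{n\setminus k}$ $(n\ge k)$ be the associated rational functions (ARFs) of order $k$ of $\{\phi_n\},\{\psi_n\}$. For $0\le j\le k\le n$ let $$K^{(j)}_{n,k}=\frac{d^{(j)}_{k\setminus j}}{c^{(j)}_{(n\setminus j),(k\setminus j)}}.$$ Then the following relations hold: (a) $2K^{(j)}_{n,k}\,\phi^{(j)}_{n\setminus j}=\left(\phi^{(j)}_{k\setminus j}+\phi^{(j)*}_{k\setminus j}\right)\phi^{(k)}_{n\setminus k}+\left(\phi^{(j)}_{k\setminus j}-\phi^{(j)*}_{k\setminus j}\right)\psi^{(k)}_{n\setminus k}$; (b) $2K^{(j)}_{n,k}\,\phi^{(j)}_{n\setminus j}=\left(\phi^{(k)}_{n\setminus k}+\psi^{(k)}_{n\setminus k}\right)\phi^{(j)}_{k\setminus j}+\left(\phi^{(k)}_{n\setminus k}-\psi^{(k)}_{n\setminus k}\right)\phi^{(j)*}_{k\setminus j}$; (c) $2\dfrac{d^{(j)}_{n\setminus j}}{d^{(j)}_{k\setminus j}}K^{(j)}_{n,k}\,P_{n\setminus k}B_{n\setminus k}\,\phi^{(j)}_{k\setminus j}=\left(\psi^{(k)*}_{n\setminus k}+\phi^{(k)*}_{n\setminus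 k}\right)\phi^{(j)}_{n\setminus j}+\left(\psi^{(k)}_{n\setminus k}-\phi^{(k)}_{n\setminus k}\right)\phi^{(j)*}_{n\setminus j}$, where $P_{n\setminus k}=P_n/P_k$ and $B_{n\setminus k}=B_n/B_k$. In the special case in which all the involved ARFs are orthonormal, it holds that $K^{(j)}_{n,k}=1$. Further, the corresponding relations for $\psi^{(j)}_{n\setminus j}$ are obtained by replacing $\phi$ with $\psi$ in (a)–(c), and vice versa.
   Context: Notation. $\mathbb{T}$ and $\mathbb{D}$ are the complex unit circle and open unit disc. The substar conjugate is $f_*(z)=\overline{f(1/\overline z)}$. Points $\beta_0,\beta_1,\ldots\in\mathbb{D}$ are fixed; $\varpi_j(z)=1-\overline{\beta_j}z$, $\varpi_j^*(z)=z-\beta_j$, $\eta_j=\overline{\beta_j}/|\beta_j|$ if $\beta_j\neq0$ and $\eta_j=1$ if $\beta_j=0$, $\zeta_j=\eta_j\varpi_j^*/\varpi_j$, $B_0=1$, $B_j=\zeta_1\cdots\zeta_j$. $\mathcal{L}_{-1}=\{0\}$, $\mathcal{L}_0=\mathbb{C}$, $\mathcal{L}_n=\mathcal{L}\{\beta_1,\ldots,\beta_n\}=\{p/(\varpi_1\cdots\varpi_n):p\text{ polynomial},\deg p\le n\}$, $\mathcal{L}=\bigcup_n\mathcal{L}_n$; $\mathcal{L}_{k\setminus k}=\mathbb{C}$, $\mathcal{L}_{n\setminus k}=\mathcal{L}\{\beta_{k+1},\ldots,\beta_n\}$. Superstar: $f^*=B_nf_*$ for $f\in\mathcal{L}_n$;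 for $f\in\mathcal{L}_{n\setminus k}$ (such as the ARFs of order $k$) $f^*=B_{n\setminus k}f_*$ with $B_{n\setminus k}=B_n/B_k$. $P_n(z)=\dfrac{\varpi_n(\beta_n)\,\varpi_0(z)\varpi_0^*(z)}{\varpi_0(\beta_0)\,\varpi_n(z)\varpi_n^*(z)}$. A C-function is an $F$ holomorphic on $\mathbb{D}$ with $\Re F>0$ on $\mathbb{D}$. Put $D_0(t,z)=\dfrac{\zeta_0(t)+\zeta_0(z)}{\zeta_0(t)-\zeta_0(z)}$. To a C-function $F$ with $F(\beta_0)=1$ corresponds the probability measure $\mu$ on $\mathbb{T}$ with $F(z)=\int_{\mathbb{T}}D_0(t,z)\,d\mu(t)$, and $\mathfrak{L}_F\{f\}=\int_{\mathbb{T}}f\,d\mu$; positive definite means $\mathfrak{L}_F\{ff_*\}>0$ for $f\in\mathcal{L}\setminus\{0\}$. $f\perp_Fg$ means $\mathfrak{L}_F\{fg_*\}=0$. The function of the second kind of $\phi_n$ is $\psi_n(z)=\mathfrak{L}_F\{D_0(t,z)[\phi_n(t)-\phi_n(z)]\}+\mathfrak{L}_F\{\phi_n(t)\}$. Recurrence and ARFs: $\{\phi_n\},\{\psi_n\}$ satisfy, for $n>0$, $$\begin{pmatrix}\phi_n&\psi_n\\ \phi_n^*&-\psi_n^*\end{pmatrix}=u_n\begin{pmatrix}1&\overline{\lambda_n}\\ \lambda_n&1\end{pmatrix}\begin{pmatrix}\zeta_{n-1}&0\\0&1\end{pmatrix}\begin{pmatrix}\phi_{n-1}&\psi_{n-1}\\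 \phi_{n-1}^*&-\psi_{n-1}^*\end{pmatrix}$$ with $\lambda_n\in\mathbb{D}$ and $u_n=e_n\begin{pmatrix}\rho_n&0\\0&\overline{\rho_n}\,\overline{\eta_{n-1}}\eta_n\end{pmatrix}\dfrac{\varpi_{n-1}}{\varpi_n}$, $|\rho_n|=1$, $e_n\in\mathbb{R}\setminus\{0\}$. The ARFs of order $k$ are the functions $\phi^{(k)}_{n\setminus k},\psi^{(k)}_{n\setminus k}\in\mathcal{L}_{n\setminus k}$, $n\ge k$, generated from initial conditions $\phi^{(k)}_{k\setminus k}=\psi^{(k)}_{k\setminus k}\in\mathbb{C}\setminus\{0\}$ by the same recurrence (same $u_n,\lambda_n,\zeta_{n-1}$) for $n>k$, with $\phi_m,\psi_m$ replaced by $\phi^{(k)}_{m\setminus k},\psi^{(k)}_{m\setminus k}$. The ARFs of order $k$ are orthogonal with respect to a C-function $F^{(k)}$ with $F^{(k)}(\beta_k)=1$ (the $\psi$'s with respect to $1/F^{(k)}$), the functional being built with $\zeta_k$ in place of $\zeta_0$ in the kernel; orthonormal means in addition $\mathfrak{L}_{F^{(k)}}\{\phi^{(k)}_{n\setminus k}\phi^{(k)}_{n\setminus k\,*}\}=1$, similarly for $\psi$. Constants: $d^{(j)}_{n\setminus j}\in\mathbb{R}\setminus\{0\}$ is the constant in the identity $\phi^{(j)*}_{n\setminus j}\psi^{(j)}_{n\setminus j}+\phi^{(j)}_{n\setminus j}\psi^{(j)*}_{n\setminus j}=d^{(j)}_{n\setminus j}P_{n\setminus j}B_{n\setminus j}$.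 The constant $c^{(j)}_{(n\setminus j),(k\setminus j)}\in\mathbb{R}\setminus\{0\}$ is the one in the representation of the ARFs of order $k$ through those of order $j$: $$\begin{pmatrix}\phi^{(k)}_{n\setminus k}&\psi^{(k)}_{n\setminus k}\\ \phi^{(k)*}_{n\setminus k}&-\psi^{(k)*}_{n\setminus k}\end{pmatrix}=\begin{pmatrix}\phi^{(j)}_{n\setminus j}&\psi^{(j)}_{n\setminus j}\\ \phi^{(j)*}_{n\setminus j}&-\psi^{(j)*}_{n\setminus j}\end{pmatrix}\begin{pmatrix}\psi^{(j)}_{k\setminus j}+\psi^{(j)*}_{k\setminus j}&-(\psi^{(j)}_{k\setminus j}-\psi^{(j)*}_{k\setminus j})\\ -(\phi^{(j)}_{k\setminus j}-\phi^{(j)*}_{k\setminus j})&\phi^{(j)}_{k\setminus j}+\phi^{(j)*}_{k\setminus j}\end{pmatrix}\left\{c^{(j)}_{(n\setminus j),(k\setminus j)}P_{k\setminus j}B_{k\setminus j}\right\}^{-1}.$$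
   Formalization: Orthonormal ARFs with initial value φ^{(k)}_{k\k} = -1 give K = -1, so ''K = 1'' fails as stated; the formal theorem proves |K| = 1 for orthonormal ARFs, and K = 1 when φ^{(k)}_{k\k} > 0. *)

(* Defs.v *)
From HB Require Import structures.
From mathcomp Require Import all_boot all_order all_algebra.
From mathcomp Require Import all_classical all_reals all_analysis.
From mathcomp Require Import complex.
Set Implicit Arguments.
Unset Strict Implicit.
Unset Printing Implicit Defensive.
Import Order.TTheory GRing.Theory Num.Theory.
Import numFieldNormedType.Exports.
Local Open Scope classical_set_scope.
Local Open Scope ring_scope.

(* The complex numbers are R[i], and rational functions are elements of the
   field C(X): identities between them hold in that field, with no exceptional
   points. *)
Notation ratfun R := {fraction {poly R[i]}}.

Definition ratC (R : realType) (c : R[i]) : ratfun R := tofrac c%:P.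
Definition ratR (R : realType) (x : R) : ratfun R := ratC (x%:C)%C.

(* Numerator and denominator in lowest terms (up to a common constant). *)
Definition numer (R : realType) (f : ratfun R) : {poly R[i]} :=
  let nd := frac (repr f) in nd.1 %/ gcdp nd.1 nd.2.
Definition denom (R : realType) (f : ratfun R) : {poly R[i]} :=
  let nd := frac (repr f) in nd.2 %/ gcdp nd.1 nd.2.

(* The value f(z); it is meaningful when z is not a pole of f. *)
Definition value (R : realType) (f : ratfun R) (z : R[i]) : R[i] :=
  (numer f).[z] / (denom f).[z].

(* The substar conjugate f_*(z) = conj (f (1 / conj z)): the coefficients are
   conjugated and X is replaced by 1 / X. *)
Definition conj_recip (R : realType) (p : {poly R[i]}) : ratfun R :=
  (map_poly (fun c : R[i] => ratC c^*) p).[(tofrac 'X)^-1].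
Definition substar (R : realType) (f : ratfun R) : ratfun R :=
  conj_recip (numer f) / conj_recip (denom f).

Definition varpi_poly (R : realType) (b : R[i]) : {poly R[i]} :=
  1 - b^* *: 'X.
Definition varpi (R : realType) (b : R[i]) : ratfun R := tofrac (varpi_poly b).
Definition varpi_star (R : realType) (b : R[i]) : ratfun R :=
  tofrac ('X - b%:P).
Definition eta (R : realType) (b : R[i]) : R[i] :=
  if b == 0 then 1 else b^* / `|b|.
Definition zeta (R : realType) (b : R[i]) : ratfun R :=
  ratC (eta b) * varpi_star b / varpi b.

(* B_n = zeta_1 ... zeta_n and B_{n\k} = B_n / B_k *)
Definition blaschke (R : realType) (beta : nat -> R[i]) (n : nat) : ratfun R :=
  \prod_(1 <= i < n.+1) zeta (beta i).
Definition blaschke_diff (R : realType) (beta : nat -> R[i]) (n k : nat) :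
    ratfun R :=
  blaschke beta n / blaschke beta k.

Definition poissonP (R : realType) (beta : nat -> R[i]) (n : nat) : ratfun R :=
  ratC (varpi_poly (beta n)).[beta n] * varpi (beta 0%N) * varpi_star (beta 0%N)
  / (ratC (varpi_poly (beta 0%N)).[beta 0%N]
     * varpi (beta n) * varpi_star (beta n)).
Definition poissonP_diff (R : realType) (beta : nat -> R[i]) (n k : nat) :
    ratfun R :=
  poissonP beta n / poissonP beta k.

(* in_L beta k n is membership in L_{n\k} = L{beta_(k+1), ..., beta_n}, for
   k <= n; in particular in_L beta 0 n is membership in L_n and in_L beta k k
   is membership in C. *)
Definition in_L (R : realType) (beta : nat -> R[i]) (k n : nat)
    (f : ratfun R) : Prop :=
  exists2 p : {poly R[i]}, (size p <= (n - k).+1)%N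
    & f = tofrac p / \prod_(k.+1 <= i < n.+1) varpi (beta i).

(* f^* = B_{n\k} f_*, for f in L_{n\k} *)
Definition superstar (R : realType) (beta : nat -> R[i]) (k n : nat)
    (f : ratfun R) : ratfun R :=
  blaschke_diff beta n k * substar f.

(* The complex plane with its Borel sigma-algebra. *)
Definition borelC (R : realType) := g_sigma_algebraType (@open R[i]^o).

Definition circle (R : realType) : set R[i] := [set t | `|t| = 1].
Arguments circle R : clear implicits.

Definition cintegral (R : realType) (mu : probability (borelC R) R)
    (f : R[i] -> R[i]) : R[i] :=
  Complex (\int[mu]_(t in circle R) complex.Re (f t))
          (\int[mu]_(t in circle R) complex.Im (f t)).

Definition C_function (R : realType) (F : R[i] -> R[i]) : Prop :=
  forall z : R[i], `|z| < 1 ->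
    derivable (F : R[i]^o -> R[i]^o) z 1 /\ 0 < complex.Re (F z).

(* The kernel D_k(t, z) built with zeta_k, where b = beta_k. *)
Definition kernel_D (R : realType) (b t z : R[i]) : R[i] :=
  (value (zeta b) t + value (zeta b) z) / (value (zeta b) t - value (zeta b) z).

(* mu is the probability measure on the unit circle corresponding to F. *)
Definition represents (R : realType) (b : R[i]) (F : R[i] -> R[i])
    (mu : probability (borelC R) R) : Prop :=
  mu (circle R) = 1%E /\
  forall z : R[i], `|z| < 1 -> F z = cintegral mu (fun t => kernel_D b t z).

Definition functional (R : realType) (mu : probability (borelC R) R)
    (f : ratfun R) : R[i] :=
  cintegral mu (value f).

Definition positive_definite (R : realType) (beta : nat -> R[i])
    (mu : probability (borelC R) R) : Prop :=
  forall (n : nat) (f : ratfun R), in_L beta 0 n f -> f != 0 ->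
    0 < functional mu (f * substar f).

(* f_n is orthogonal to L_{(n-1)\k} for every n >= k, L_{(k-1)\k} being {0}. *)
Definition orthogonal_seq (R : realType) (beta : nat -> R[i]) (k : nat)
    (mu : probability (borelC R) R) (f : nat -> ratfun R) : Prop :=
  forall (n : nat) (g : ratfun R), (k < n)%N -> in_L beta k n.-1 g ->
    functional mu (f n * substar g) = 0.

(* A rational function is determined by its values on the unit disc, where the
   elements of L have no pole. *)
Definition second_kind (R : realType) (b : R[i])
    (mu : probability (borelC R) R) (phi psi : ratfun R) : Prop :=
  forall z : R[i], `|z| < 1 ->
    value psi z =
      cintegral mu (fun t => kernel_D b t z * (value phi t - value phi z))
      + functional mu phi.

Definition mat2 (A : Type) (a b c d : A) : 'M[A]_2 :=
  \matrix_(i < 2, j < 2)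
    if i == 0 then (if j == 0 then a else b) else (if j == 0 then c else d).

Definition arf_mx (R : realType) (beta : nat -> R[i]) (k n : nat)
    (phi psi : nat -> ratfun R) : 'M[ratfun R]_2 :=
  mat2 (phi n) (psi n)
       (superstar beta k n (phi n)) (- superstar beta k n (psi n)).

Definition u_mx (R : realType) (beta : nat -> R[i]) (e : nat -> R)
    (rho : nat -> R[i]) (n : nat) : 'M[ratfun R]_2 :=
  (ratR (e n) * (varpi (beta n.-1) / varpi (beta n))) *:
  mat2 (ratC (rho n)) 0
       0 (ratC ((rho n)^* * (eta (beta n.-1))^* * eta (beta n))).

Definition recurrence (R : realType) (beta : nat -> R[i]) (lam : nat -> R[i])
    (e : nat -> R) (rho : nat -> R[i]) (k : nat)
    (phi psi : nat -> ratfun R) : Prop :=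
  forall n : nat, (k < n)%N ->
    arf_mx beta k n phi psi =
      u_mx beta e rho n
      *m mat2 1 (ratC (lam n)^*) (ratC (lam n)) 1
      *m mat2 (zeta (beta n.-1)) 0 0 1
      *m arf_mx beta k n.-1 phi psi.

(* phi n, psi n (n >= k) are the associated rational functions of order k with
   initial value a. *)
Definition is_ARF (R : realType) (beta : nat -> R[i]) (lam : nat -> R[i])
    (e : nat -> R) (rho : nat -> R[i]) (k : nat) (a : R[i])
    (phi psi : nat -> ratfun R) : Prop :=
  [/\ a != 0,
      phi k = ratC a /\ psi k = ratC a,
      forall n : nat, (k <= n)%N ->
        in_L beta k n (phi n) /\ in_L beta k n (psi n)
    & recurrence beta lam e rho k phi psi].

Definition orthonormal_seq (R : realType) (beta : nat -> R[i]) (k : nat)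
    (mu : probability (borelC R) R) (f : nat -> ratfun R) : Prop :=
  orthogonal_seq beta k mu f /\
  forall n : nat, (k <= n)%N -> functional mu (f n * substar (f n)) = 1.

(* The phi's are orthonormal with respect to a C-function F normalized at
   beta_k, and the psi's with respect to 1 / F. *)
Definition orthonormal_ARF (R : realType) (beta : nat -> R[i]) (k : nat)
    (phi psi : nat -> ratfun R) : Prop :=
  exists (F : R[i] -> R[i]) (mu nu : probability (borelC R) R),
    [/\ C_function F /\ F (beta k) = 1,
        represents (beta k) F mu,
        represents (beta k) (fun z => (F z)^-1) nu,
        orthonormal_seq beta k mu phi
      & orthonormal_seq beta k nu psi].

(* d is the constant d^(j)_{n\j}. *)
Definition is_d (R : realType) (beta : nat -> R[i]) (j n : nat)
    (phi psi : nat -> ratfun R) (d : R) : Prop :=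
  d != 0 /\
  superstar beta j n (phi n) * psi n + phi n * superstar beta j n (psi n)
    = ratR d * poissonP_diff beta n j * blaschke_diff beta n j.

(* c is the constant c^(j)_{(n\j),(k\j)}; phij, psij are the functions of order
   j and phik, psik those of order k. *)
Definition is_c (R : realType) (beta : nat -> R[i]) (j k n : nat)
    (phij psij phik psik : nat -> ratfun R) (c : R) : Prop :=
  let phis := superstar beta j k (phij k) in
  let psis := superstar beta j k (psij k) in
  c != 0 /\
  arf_mx beta k n phik psik =
    (ratR c * poissonP_diff beta k j * blaschke_diff beta k j)^-1 *:
    (arf_mx beta j n phij psij
     *m mat2 (psij k + psis) (- (psij k - psis))
             (- (phij k - phis)) (phij k + phis)).

(* The relations (a), (b) and (c) for phi; exchanging the phi's and the psi's
   gives those for psi. *)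
Definition relations (R : realType) (beta : nat -> R[i]) (j k n : nat)
    (dk dn K : R) (phij phik psik : nat -> ratfun R) : Prop :=
  let phijk_s := superstar beta j k (phij k) in
  let phijn_s := superstar beta j n (phij n) in
  let phikn_s := superstar beta k n (phik n) in
  let psikn_s := superstar beta k n (psik n) in
  [/\ ratR (2 * K) * phij n =
        (phij k + phijk_s) * phik n + (phij k - phijk_s) * psik n,
      ratR (2 * K) * phij n =
        (phik n + psik n) * phij k + (phik n - psik n) * phijk_s
    & ratR (2 * (dn / dk) * K)
        * poissonP_diff beta n k * blaschke_diff beta n k * phij k =
        (psikn_s + phikn_s) * phij n + (psik n - phik n) * phijn_s].

(* Main.v *)
Require Import Defs.
From HB Require Import structures.
From mathcomp Require Import all_boot all_order all_algebra.
From mathcomp Require Import all_classical all_reals all_analysis.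
From mathcomp Require Import complex.
From mathcomp Require Import ring.
Import Order.TTheory GRing.Theory Num.Theory.
Import numFieldNormedType.Exports.
Local Open Scope classical_set_scope.
Local Open Scope ring_scope.

(** The recurrence multiplies the 2x2 matrix of the functions of order l by a
    transfer matrix T_n that does not depend on l. Hence, for l <= k <= n, the
    matrix of order l at n is S = T_n ... T_(k+1) times the one at k, with the
    same S for l = j and for l = k ([transfer_product]). Moreover
    det T_n = r (P_n / P_(n-1)) zeta_n with r real and nonzero
    ([det_transfer]), so det S is a nonzero real multiple of
    P_{n\k} B_{n\k}.

    The constant d. Up to sign, the combination that defines d is the
    determinant of the matrix of order j at n, and the matrix at the initial
    index j, with rows (a_j, a_j) and (conj a_j, - conj a_j), has the real
    determinant - 2 |a_j|^2.

    The constant c. Let N be the right factor in the representation of the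
    functions of order k through those of order j. Its product with the matrix
    of order j at k is d P_{k\j} B_{k\j} times the matrix with rows (1, 1) and
    (1, -1) ([arf_mx_connect]). The matrix of order k at k is a_k times this
    same matrix when a_k is real, and multiplying by S gives the
    representation, with c = d / a_k. Conversely S can be cancelled in any such
    representation, which leaves a_k = d / c = K ([is_c_initial]).

    The relations. N has determinant 2 d P_{k\j} B_{k\j}, so multiplying the
    representation by the adjugate of N solves it for the functions of order j;
    this is (a), and (b) is a rearrangement of it. For (c) one substitutes the
    representation on the right, where everything collapses to the combination
    that defines d at n ([relations_field]). Exchanging the phi's and the
    psi's only permutes the four scalar equations of the representation.

    Orthonormality. At the initial index the norm of the constant a_k is
    |a_k|^2, because the measure has total mass 1 on the circle; so
    |K| = |a_k| = 1. *)

Set Implicit Arguments.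
Unset Strict Implicit.

(** * Matrices of size two *)

Section Mat2.
Variable K : fieldType.
Implicit Types a b c d x : K.

Lemma mat2_mul a b c d a' b' c' d' :
  mat2 a b c d *m mat2 a' b' c' d' =
  mat2 (a * a' + b * c') (a * b' + b * d') (c * a' + d * c') (c * b' + d * d').
Proof.
apply/matrixP=> i l; rewrite !mxE !big_ord_recl big_ord0 !mxE /= addr0.
by case: i l => [[|[|//]] hi] [[|[|//]] hl].
Qed.

Lemma mat2_scale x a b c d :
  x *: mat2 a b c d = mat2 (x * a) (x * b) (x * c) (x * d).
Proof.
by apply/matrixP=> i l; rewrite !mxE; case: (i == 0); case: (l == 0).
Qed.

Lemma det_mat2 a b c d : \det (mat2 a b c d) = a * d - b * c.
Proof.
rewrite (expand_det_row _ 0) !big_ord_recl big_ord0 addr0 /cofactor.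
by rewrite !det_mx11 !mxE /= expr0 expr1 mul1r mulN1r mulrN.
Qed.

Lemma mat2_inj a b c d a' b' c' d' :
  mat2 a b c d = mat2 a' b' c' d' -> [/\ a = a', b = b', c = c' & d = d'].
Proof.
move/matrixP=> E.
by move: (E 0 0) (E 0 1) (E 1 0) (E 1 1); rewrite !mxE /=.
Qed.

End Mat2.

(** * Identities in an arbitrary field *)

Section FieldIdentities.
Variable K : fieldType.

Lemma div_div_cancel (x y z : K) : z != 0 -> x / y = x / z / (y / z).
Proof. by move=> z0; rewrite invf_div mulrA divfK. Qed.

Lemma scaled_ratio (c d P B : K) :
  P != 0 -> B != 0 -> (c * P * B)^-1 * (d * P * B) = d / c.
Proof.
move=> P0 B0; rewrite !invfM.
rewrite [LHS](_ : _ = d / c * (P^-1 * P) * (B^-1 * B)); last by ring.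
by rewrite !mulVf // !mulr1.
Qed.

Lemma telescope_step (q r P1 Pn Pk Bn Bk Z : K) :
  Pn != 0 -> Bn != 0 ->
  q * (P1 / Pn) * Z * (r * (Pn / Pk) * (Bn / Bk)) =
  q * r * (P1 / Pk) * (Bn * Z / Bk).
Proof.
move=> Pn0 Bn0.
rewrite [LHS](_ : _ = q * r * (P1 * (Pn^-1 * Pn) / Pk) * (Bn * Z / Bk)).
  by rewrite mulVf // mulr1.
by ring.
Qed.

(** Here (x, V, S0, eta0) stand for the value varpi(beta), varpi, varpi^* and
    eta at index n-1, (y, W, S1, eta1) for those at index n, and
    (X00, V00, S00) for the first three at index 0; the names ending in c are
    conjugates. Both sides equal E^2 w V S0 eta1 / W^2. *)
Lemma det_transfer_field
    (E w x y V W S0 S1 V00 S00 X00 eta0 eta0c eta1 r rc l lc : K) :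
  [/\ x != 0, y != 0 & X00 != 0] ->
  [/\ V != 0, W != 0 & V00 != 0] -> [/\ S0 != 0, S1 != 0 & S00 != 0] ->
  eta0 * eta0c = 1 -> r * rc = 1 -> 1 - l * lc = w ->
  \det ((E * (V / W)) *: mat2 r 0 0 (rc * eta0c * eta1)
        *m mat2 1 lc l 1 *m mat2 (eta0 * S0 / V) 0 0 1) =
  E ^+ 2 * w * (x / y)
    * (y * V00 * S00 / (X00 * W * S1) / (x * V00 * S00 / (X00 * V * S0)))
    * (eta1 * S1 / W).
Proof.
move=> [x0 y0 X0] [V0 W0 V000] [S00' S10 S000] eeta er <-.
rewrite mat2_scale !det_mulmx !det_mat2 !mulr0 !subr0 !mulr1.
transitivity (E ^+ 2 * (1 - lc * l) * V * S0 * eta1 / W ^+ 2).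
  have -> : E ^+ 2 * (1 - lc * l) * V * S0 * eta1 / W ^+ 2 =
    E ^+ 2 * (1 - lc * l) * V * S0 * eta1 / W ^+ 2 * (eta0 * eta0c) * (r * rc).
    by rewrite eeta er !mulr1.
  by field; rewrite V0 W0.
by field; rewrite x0 y0 X0 V0 W0 V000 S00' S10 S000.
Qed.

Lemma d_of_det (r P B s b f g fs gs : K) :
  f * - gs - g * fs = r * P * B * (s * - b - s * b) ->
  fs * g + f * gs = 2 * r * (s * b) * P * B.
Proof.
move=> E; rewrite [LHS](_ : _ = - (f * - gs - g * fs)); last by ring.
by rewrite E; ring.
Qed.

Lemma mat2_connect (f g fs gs : K) :
  mat2 f g fs (- gs) *m mat2 (g + gs) (- (g - gs)) (- (f - fs)) (f + fs) =
  (fs * g + f * gs) *: mat2 1 1 1 (- 1).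
Proof. by rewrite mat2_mul mat2_scale; congr mat2; ring. Qed.

(** The names f, g are for phi, psi of order j, and u, v for phi, psi of order
    k; the suffixes k, n are indices, and s marks a superstar. The hypotheses
    are symmetric under (f, u) <-> (g, v), which is what makes the relations
    for the psi's another instance. *)
Lemma relations_field (c dk dn Pk Bk Pn Bn : K)
   (fk fks gk gks fn fns gn gns un uns vn vns : K) :
  c * Pk * Bk != 0 -> dk != 0 ->
  fks * gk + fk * gks = dk * Pk * Bk ->
  fns * gn + fn * gns = dn * Pn * Bn ->
  un = (c * Pk * Bk)^-1 * (fn * (gk + gks) - gn * (fk - fks)) ->
  vn = (c * Pk * Bk)^-1 * (gn * (fk + fks) - fn * (gk - gks)) ->
  uns = (c * Pk * Bk)^-1 * (fns * (gk + gks) + gns * (fk - fks)) ->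
  vns = (c * Pk * Bk)^-1 * (gns * (fk + fks) + fns * (gk - gks)) ->
  [/\ 2 * (dk / c) * fn = (fk + fks) * un + (fk - fks) * vn,
      2 * (dk / c) * fn = (un + vn) * fk + (un - vn) * fks
    & 2 * (dn / dk) * (dk / c) * (Pn / Pk) * (Bn / Bk) * fk =
      (vns + uns) * fn + (vn - un) * fns].
Proof.
move=> X0 dk0 Dk Dn -> -> -> ->.
have [[c0 P0] B0] : (c != 0 /\ Pk != 0) /\ Bk != 0.
  by move: X0; rewrite !mulf_eq0 !negb_or -andbA => /and3P[].
(* Rewriting the left sides so that d P B occurs in them lets its definition
   be substituted; what remains is polynomial. *)
have A1 : 2 * (dk / c) * fn = (c * Pk * Bk)^-1 * (2 * (dk * Pk * Bk)) * fn.
  by field; rewrite c0 P0 B0.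
have A2 : 2 * (dn / dk) * (dk / c) * (Pn / Pk) * (Bn / Bk) * fk =
  (c * Pk * Bk)^-1 * (2 * (dn * Pn * Bn)) * fk.
  by field; rewrite c0 dk0 P0 B0.
by split; rewrite ?A1 ?A2 -?Dk -?Dn; ring.
Qed.

End FieldIdentities.

(** * Constants as rational functions *)

Section Constants.
Variable R : realType.
Implicit Types (c : R[i]) (x : R).

Lemma ratC_is_rmorph : zmod_morphism (@ratC R) * monoid_morphism (@ratC R).
Proof.
split; first by move=> c d; rewrite /ratC !rmorphB.
by split=> [|c d]; rewrite /ratC ?rmorph1 // !rmorphM.
Qed.

HB.instance Definition _ :=
  GRing.isZmodMorphism.Build R[i] (ratfun R) (@ratC R) ratC_is_rmorph.1.
HB.instance Definition _ :=
  GRing.isMonoidMorphism.Build R[i] (ratfun R) (@ratC R) ratC_is_rmorph.2.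
HB.instance Definition _ :=
  GRing.RMorphism.copy (@ratR R) (@ratC R \o real_complex R).

(** The representative of a fraction, and the gcd by which it is reduced, are
    known only up to a factor; hence the unknown nonzero constant u. *)
Lemma numer_denom_ratC c :
  exists2 u : R[i], u != 0
    & numer (ratC c) = (c * u)%:P /\ denom (ratC c) = u%:P.
Proof.
rewrite /numer /denom; set q := repr (ratC c).
have d0 : (frac q).2 != 0 by exact: denom_ratioP.
have -> : (frac q).1 = c *: (frac q).2.
  have := FracField.equivf_l (Ratio c%:P 1).
  rewrite !numden_Ratio ?oner_neq0 // mulr1.
  rewrite /q /ratC /tofrac; unlock FracField.tofrac => ->.
  by rewrite mulrC mul_polyC.
set p := (frac q).2 in d0 *.
have /dvdp_gcd_idr gp : p %| c *: p by rewrite -mul_polyC dvdp_mull.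
have g0 : gcdp (c *: p) p != 0 by rewrite gcdp_eq0 negb_and d0 orbT.
have : size (p %/ gcdp (c *: p) p) == 1%N.
  by rewrite size_divp // (eqp_size gp) polySpred //= subSnn.
case/size_poly1P => u u0 E.
by exists u => //; rewrite divpZl E -mul_polyC polyCM.
Qed.

Lemma value_ratC c z : value (ratC c) z = c.
Proof.
rewrite /value; have [u u0 [-> ->]] := numer_denom_ratC c.
by rewrite !hornerC mulfK.
Qed.

Lemma conj_recipC c : conj_recip c%:P = ratC c^*.
Proof. by rewrite /conj_recip (map_polyC (@ratC R \o Num.conj)) hornerC. Qed.

Lemma substar_ratC c : substar (ratC c) = ratC c^*.
Proof.
rewrite /substar; have [u u0 [-> ->]] := numer_denom_ratC c.
by rewrite !conj_recipC !rmorphM mulfK // fmorph_eq0 conjC_eq0.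
Qed.

Lemma measurable_circle : measurable (circle R : set (borelC R)).
Proof.
rewrite -(setCK (circle R)); apply: measurableC; apply: sub_sigma_algebra.
rewrite openC.
have /continuous_closedP := @norm_continuous R[i] R[i]^o.
move/(_ [set 1]); apply.
apply: accessible_closed_set1; apply: hausdorff_accessible.
exact: norm_hausdorff.
Qed.

Lemma functional_ratC (mu : probability (borelC R) R) c :
  mu (circle R) = 1%E -> functional mu (ratC c) = c.
Proof.
move=> m1; rewrite /functional /cintegral.
have E (f : R[i] -> R) :
    (\int[mu]_(t in circle R) f (value (ratC c) t)) = f c.
  under eq_Rintegral do rewrite value_ratC.
  rewrite Rintegral_cst; last exact: measurable_circle.
  by rewrite [X in fine X]m1 mulr1.
by rewrite !E; case: c {E}.
Qed.

End Constants.

(** * Blaschke factors and Poisson kernels *)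

Section Factors.
Variable R : realType.
Implicit Types b : R[i].

Lemma varpi_neq0 b : varpi b != 0.
Proof.
rewrite /varpi tofrac_eq0; apply/eqP => /(congr1 (horner^~ 0)).
by rewrite /varpi_poly !hornerE ?mulr0 ?subr0 => /eqP; rewrite oner_eq0.
Qed.

Lemma varpi_star_neq0 b : varpi_star b != 0.
Proof. by rewrite /varpi_star tofrac_eq0 polyXsubC_eq0. Qed.

Lemma eta_norm b : Defs.eta b * (Defs.eta b)^* = 1.
Proof.
rewrite -normCK /Defs.eta; case: eqVneq => [_|b0].
  by rewrite normr1 expr1n.
by rewrite normrM normfV normr_id norm_conjC divff ?normr_eq0 // expr1n.
Qed.

Lemma eta_neq0 b : Defs.eta b != 0.
Proof.
by apply/eqP => e0; have /eqP := eta_norm b; rewrite e0 mul0r eq_sym oner_eq0.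
Qed.

Lemma zeta_neq0 b : zeta b != 0.
Proof.
rewrite /zeta; apply: mulf_neq0; last by rewrite invr_neq0 ?varpi_neq0.
by apply: mulf_neq0; rewrite ?varpi_star_neq0 // fmorph_eq0 eta_neq0.
Qed.

Lemma varpi_self b : (varpi_poly b).[b] = 1 - `|b| ^+ 2.
Proof. by rewrite /varpi_poly !hornerE normCK mulrC. Qed.

(** The numbers 1 - |lambda_n|^2 and varpi_n(beta_n) both have this form, and
    this is what makes the scalar factor of det T_n real and nonzero. *)
Lemma one_sub_sqr_norm_real b : `|b| < 1 ->
  exists2 x : R, x != 0 & 1 - `|b| ^+ 2 = (x%:C)%C.
Proof.
move=> b1; have /complex_realP[x Ex] : 1 - `|b| ^+ 2 \is Num.real.
  by rewrite rpredB ?rpred1 // rpredX // ger0_real.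
exists x => //; rewrite -(fmorph_eq0 (real_complex R)) /= -Ex.
by rewrite subr_eq0 eq_sym lt_eqF // expr_lt1.
Qed.

Variable beta : nat -> R[i].
Hypothesis hbeta : forall i, `|beta i| < 1.

Lemma blaschkeS n : blaschke beta n.+1 = blaschke beta n * zeta (beta n.+1).
Proof. by rewrite /blaschke big_nat_recr. Qed.

Lemma blaschke_neq0 n : blaschke beta n != 0.
Proof.
by rewrite /blaschke prodf_seq_neq0; apply/allP => i _; rewrite zeta_neq0.
Qed.

Lemma varpi_self_neq0 n : (varpi_poly (beta n)).[beta n] != 0.
Proof.
rewrite varpi_self; have [x x0 ->] := one_sub_sqr_norm_real (hbeta n).
by rewrite fmorph_eq0.
Qed.

Lemma poissonP_neq0 n : poissonP beta n != 0.
Proof.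
have nz m b : ratC (varpi_poly (beta m)).[beta m] * varpi b * varpi_star b != 0.
  apply: mulf_neq0 (varpi_star_neq0 b); apply: mulf_neq0 (varpi_neq0 b).
  by rewrite fmorph_eq0 varpi_self_neq0.
by apply: mulf_neq0; last apply: invr_neq0; exact: nz.
Qed.

Lemma blaschke_diff_neq0 n k : blaschke_diff beta n k != 0.
Proof. by rewrite mulf_neq0 ?invr_neq0 ?blaschke_neq0. Qed.

Lemma poissonP_diff_neq0 n k : poissonP_diff beta n k != 0.
Proof. by rewrite mulf_neq0 ?invr_neq0 ?poissonP_neq0. Qed.

Lemma blaschke_diffnn n : blaschke_diff beta n n = 1.
Proof. exact: divff (blaschke_neq0 n). Qed.

Lemma poissonP_diffnn n : poissonP_diff beta n n = 1.
Proof. exact: divff (poissonP_neq0 n). Qed.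

Lemma scaled_PB_neq0 (r : R) n k :
  r != 0 -> ratR r * poissonP_diff beta n k * blaschke_diff beta n k != 0.
Proof.
move=> r0; apply: mulf_neq0; last exact: blaschke_diff_neq0.
by apply: mulf_neq0; [rewrite fmorph_eq0 | exact: poissonP_diff_neq0].
Qed.

Lemma arf_mx_init k (phi psi : nat -> ratfun R) c :
  phi k = ratC c -> psi k = ratC c ->
  arf_mx beta k k phi psi =
    mat2 (ratC c) (ratC c) (ratC c^*) (- ratC c^*).
Proof.
move=> E1 E2.
by rewrite /arf_mx /superstar E1 E2 substar_ratC blaschke_diffnn mul1r.
Qed.

End Factors.

(** * Transfer matrices *)

Section Transfer.
Variables (R : realType) (beta : nat -> R[i]).
Hypothesis hbeta : forall i, `|beta i| < 1.
Variables (lam : nat -> R[i]) (e : nat -> R) (rho : nat -> R[i]).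
Hypothesis hpar : forall n : nat, (0 < n)%N ->
  [/\ `|lam n| < 1, e n != 0 & `|rho n| = 1].

Definition transfer n : 'M[ratfun R]_2 :=
  u_mx beta e rho n
  *m mat2 1 (ratC (lam n)^*) (ratC (lam n)) 1
  *m mat2 (zeta (beta n.-1)) 0 0 1.

Lemma det_transfer n : exists2 r : R, r != 0 &
  \det (transfer n.+1) =
    ratR r * poissonP_diff beta n.+1 n * zeta (beta n.+1).
Proof.
have [l1 e0 r1] := hpar (ltn0Sn n).
have [x x0 Ex] := one_sub_sqr_norm_real (hbeta n).
have [y y0 Ey] := one_sub_sqr_norm_real (hbeta n.+1).
have [w w0 Ew] := one_sub_sqr_norm_real l1.
(* x / y cancels the normalizing constants of P_(n+1) / P_n. *)
exists (e n.+1 ^+ 2 * w * (x / y)).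
  by rewrite !mulf_neq0 ?invr_eq0 // expf_neq0.
have -> : ratR (e n.+1 ^+ 2 * w * (x / y)) =
    ratR (e n.+1) ^+ 2 * ratR w * (ratR x / ratR y) :> ratfun R.
  by rewrite !rmorphM fmorphV -!expr2.
rewrite /transfer /u_mx /poissonP_diff /poissonP /zeta !rmorphM.
rewrite (varpi_self (beta n)) (varpi_self (beta n.+1)) Ex Ey.
apply: det_transfer_field.
- by split; rewrite fmorph_eq0 // varpi_self_neq0.
- by split; exact: varpi_neq0.
- by split; exact: varpi_star_neq0.
- by rewrite -rmorphM eta_norm rmorph1.
- by rewrite -rmorphM -normCK r1 expr1n rmorph1.
- by rewrite -rmorphM -normCK -[1](rmorph1 (@ratC R)) -rmorphB Ew.
Qed.

(** The order l is quantified after S: one S serves all orders up to k, which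
    is what relates the functions of order j and of order k. *)
Lemma transfer_product k n : (k <= n)%N ->
  exists S : 'M[ratfun R]_2, exists2 r : R, r != 0 &
    \det S = ratR r * poissonP_diff beta n k * blaschke_diff beta n k /\
    forall l (phi psi : nat -> ratfun R), (l <= k)%N ->
      recurrence beta lam e rho l phi psi ->
      arf_mx beta l n phi psi = S *m arf_mx beta l k phi psi.
Proof.
move=> /subnK <-; elim: (n - k)%N => [|m IHm].
  exists 1%:M; exists 1; rewrite ?oner_neq0 //.
  split=> [|l phi psi _ _]; last by rewrite mul1mx.
  by rewrite det1 poissonP_diffnn // blaschke_diffnn rmorph1 !mulr1.
have [S [r r0 [detS recS]]] := IHm.
have [q q0 detT] := det_transfer (m + k).
exists (transfer (m + k).+1 *m S); exists (q * r); rewrite ?mulf_neq0 //.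
rewrite addSn; split=> [|l phi psi lk rec]; last first.
  by rewrite -mulmxA -recS // -rec // ltnS (leq_trans lk) ?leq_addl.
rewrite det_mulmx detT detS rmorphM /poissonP_diff /blaschke_diff blaschkeS.
by apply: telescope_step; [exact: poissonP_neq0 | exact: blaschke_neq0].
Qed.

(** * The constants d and c *)

Variables (a : nat -> R[i]) (phiA psiA : nat -> nat -> ratfun R).
Hypothesis hARF :
  forall k : nat, is_ARF beta lam e rho k (a k) (phiA k) (psiA k).

Lemma is_d_exists j n : (j <= n)%N ->
  exists d : R, is_d beta j n (phiA j) (psiA j) d.
Proof.
move=> jn; have [S [r r0 [detS recS]]] := transfer_product jn.
have [a0 [Ephi Epsi] _ rec] := hARF j.
have [t Et] : exists t : R, a j * (a j)^* = (t%:C)%C.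
  by apply/complex_realP; rewrite -normCK rpredX // ger0_real.
have t0 : t != 0.
  by rewrite -(fmorph_eq0 (real_complex R)) /= -Et mulf_neq0 ?conjC_eq0.
exists (2 * r * t); split; first by rewrite !mulf_neq0 ?pnatr_eq0.
have := congr1 determinant (recS j _ _ (leqnn j) rec).
rewrite det_mulmx detS (arf_mx_init beta Ephi Epsi) !det_mat2 => /d_of_det ->.
have -> // : ratR (2 * r * t) = 2 * ratR r * (ratC (a j) * ratC (a j)^*).
by rewrite !rmorphM /= rmorph_nat -[ratC (a j) * _]rmorphM Et.
Qed.

Lemma arf_mx_connect j k d :
  is_d beta j k (phiA j) (psiA j) d ->
  let phis := superstar beta j k (phiA j k) in
  let psis := superstar beta j k (psiA j k) in
  arf_mx beta j k (phiA j) (psiA j)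
    *m mat2 (psiA j k + psis) (- (psiA j k - psis))
            (- (phiA j k - phis)) (phiA j k + phis) =
  (ratR d * poissonP_diff beta k j * blaschke_diff beta k j)
    *: mat2 1 1 1 (- 1).
Proof. by move=> [_ <-] /=; exact: mat2_connect. Qed.

(** For a real a_k, the initial matrix of order k is a_k times the constant
    matrix of [arf_mx_connect]. *)
Lemma is_c_exists j k n : (j <= k)%N -> (k <= n)%N -> a k \is Num.real ->
  exists c : R, is_c beta j k n (phiA j) (psiA j) (phiA k) (psiA k) c.
Proof.
move=> jk kn ar; have [d hd] := is_d_exists jk; have [d0 _] := hd.
have [S [r r0 [detS recS]]] := transfer_product kn.
have [_ _ _ recj] := hARF j; have [a0 [Ephi Epsi] _ reck] := hARF k.
have /complex_realP[t Et] := ar.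
have t0 : t != 0 by rewrite -(fmorph_eq0 (real_complex R)) /= -Et.
exists (d / t); split; first by rewrite mulf_neq0 ?invr_eq0.
rewrite (recS j) // (recS k) // -mulmxA (arf_mx_connect hd).
rewrite (arf_mx_init beta Ephi Epsi) scalemxAr scalerA; congr (_ *m _).
rewrite (CrealP ar) Et -/(ratR t) mat2_scale.
rewrite scaled_ratio ?poissonP_diff_neq0 ?blaschke_diff_neq0 //.
have -> : ratR d / ratR (d / t) = ratR t.
  by rewrite rmorphM fmorphV invf_div mulrC divfK // fmorph_eq0.
by rewrite !mulrN !mulr1.
Qed.

(** The two representations of the matrix of order k at n, by S and through
    the functions of order j, can be compared at index k since S is
    invertible; the corner entry gives a_k. *)
Lemma is_c_initial j k n d c : (j <= k)%N -> (k <= n)%N ->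
  is_d beta j k (phiA j) (psiA j) d ->
  is_c beta j k n (phiA j) (psiA j) (phiA k) (psiA k) c ->
  a k = ((d / c)%:C)%C.
Proof.
move=> jk kn hd [c0 /=].
have [S [r r0 [detS recS]]] := transfer_product kn.
have [_ _ _ recj] := hARF j; have [a0 [Ephi Epsi] _ reck] := hARF k.
rewrite (recS j) // (recS k) // -mulmxA (arf_mx_connect hd) scalemxAr.
have uS : S \in unitmx.
  by rewrite unitmxE detS unitfE; exact: scaled_PB_neq0.
move/(can_inj (mulKmx uS)).
rewrite (arf_mx_init beta Ephi Epsi) scalerA mat2_scale => /mat2_inj[+ _ _ _].
rewrite mulr1 scaled_ratio ?poissonP_diff_neq0 ?blaschke_diff_neq0 //.
by rewrite -fmorphV -rmorphM; exact: (fmorph_inj (@ratC R)).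
Qed.

(** * The relations and the orthonormal case *)

Lemma relations_of_c j k n dk dn c :
  is_d beta j k (phiA j) (psiA j) dk ->
  is_d beta j n (phiA j) (psiA j) dn ->
  is_c beta j k n (phiA j) (psiA j) (phiA k) (psiA k) c ->
  relations beta j k n dk dn (dk / c) (phiA j) (phiA k) (psiA k) /\
  relations beta j k n dk dn (dk / c) (psiA j) (psiA k) (phiA k).
Proof.
move=> [dk0 Dk] [_ Dn] [c0 /=].
rewrite mat2_mul mat2_scale => /mat2_inj[e1 e2 e3 e4].
rewrite mulrN in e1; rewrite mulrN addrC in e2; rewrite mulrNN in e3.
rewrite mulNr mulrN -opprD mulrN addrC in e4; move/oppr_inj in e4.
have X0 := scaled_PB_neq0 hbeta k j c0.
have dk0' : ratR dk != 0 by rewrite fmorph_eq0.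
have PE := div_div_cancel (poissonP beta n) (poissonP beta k)
  (poissonP_neq0 hbeta j).
have BE := div_div_cancel (blaschke beta n) (blaschke beta k)
  (blaschke_neq0 beta j).
have E2 : ratR (2 * (dk / c)) = 2 * (ratR dk / ratR c).
  by rewrite !rmorphM fmorphV rmorph_nat.
have E3 : ratR (2 * (dn / dk) * (dk / c)) =
    2 * (ratR dn / ratR dk) * (ratR dk / ratR c).
  by rewrite !rmorphM !fmorphV rmorph_nat.
rewrite /relations E2 E3 [poissonP_diff beta n k]PE [blaschke_diff beta n k]BE.
split; first exact: (relations_field X0 dk0' Dk Dn e1 e2 e3 e4).
apply: (relations_field X0 dk0' _ _ e2 e1 e4 e3).
  by rewrite -Dk addrC mulrC [X in _ + X]mulrC.
by rewrite -Dn addrC mulrC [X in _ + X]mulrC.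
Qed.

Lemma orthonormal_initial k :
  orthonormal_ARF beta k (phiA k) (psiA k) -> `|a k| = 1.
Proof.
move=> [F [mu [nu [_ [m1 _] _ [_ /(_ k (leqnn k)) nrm] _]]]].
have [_ [Ephi _] _ _] := hARF k.
move: nrm; rewrite Ephi substar_ratC -rmorphM functional_ratC //.
by rewrite -normCK => /eqP; rewrite pexpr_eq1 // => /eqP.
Qed.

End Transfer.

Unset Implicit Arguments.
Set Strict Implicit.

Theorem corollary15 (R : realType) (beta : nat -> R[i])
    (hbeta : forall i : nat, `|beta i| < 1)
    (F : R[i] -> R[i]) (mu : probability (borelC R) R)
    (hF : C_function F) (hF0 : F (beta 0%N) = 1)
    (hmu : represents (beta 0%N) F mu) (hpos : positive_definite beta mu)
    (phi psi : nat -> ratfun R)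
    (hphi : forall n : nat, in_L beta 0 n (phi n) /\ phi n != 0)
    (horth : orthogonal_seq beta 0 mu phi)
    (hpsi : forall n : nat, second_kind (beta 0%N) mu (phi n) (psi n))
    (lam : nat -> R[i]) (e : nat -> R) (rho : nat -> R[i])
    (hpar : forall n : nat, (0 < n)%N ->
       [/\ `|lam n| < 1, e n != 0 & `|rho n| = 1])
    (hrec : recurrence beta lam e rho 0 phi psi)
    (a : nat -> R[i]) (phiA psiA : nat -> nat -> ratfun R)
    (hARF : forall k : nat, is_ARF beta lam e rho k (a k) (phiA k) (psiA k))
    (j k n : nat) (hjk : (j <= k)%N) (hkn : (k <= n)%N) :
  [/\ exists dn : R, is_d beta j n (phiA j) (psiA j) dn,
      a k \is Num.real -> exists c : R,
        is_c beta j k n (phiA j) (psiA j) (phiA k) (psiA k) c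
    & forall dk dn c : R,
        is_d beta j k (phiA j) (psiA j) dk ->
        is_d beta j n (phiA j) (psiA j) dn ->
        is_c beta j k n (phiA j) (psiA j) (phiA k) (psiA k) c ->
        let K := dk / c in
        [/\ relations beta j k n dk dn K (phiA j) (phiA k) (psiA k),
            relations beta j k n dk dn K (psiA j) (psiA k) (phiA k)
          & orthonormal_ARF beta j (phiA j) (psiA j) ->
            orthonormal_ARF beta k (phiA k) (psiA k) ->
            `|K| = 1 /\ (0 < a k -> K = 1)]].
Proof.
split.
- exact: (is_d_exists hbeta hpar hARF (leq_trans hjk hkn)).
- exact: (is_c_exists hbeta hpar hARF hjk hkn).
move=> dk dn c hdk hdn hc K.
have [rel1 rel2] := relations_of_c hbeta hdk hdn hc.
split=> // _ ortho_k.
have := orthonormal_initial hARF ortho_k.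
rewrite (is_c_initial hbeta hpar hARF hjk hkn hdk hc) -/K => nK.
have K1 : `|K| = 1.
  apply: (@complexI R); move: nK.
  by rewrite normc_def /= expr0n addr0 sqrtr_sqr.
by split=> //; rewrite (ltcR 0) => K0; rewrite -K1 gtr0_norm.
Qed.
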